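(* For every graph $G$ and every positive integer $d$, $$\chi_f^d(G\boxtimes K_{d+1})=\chi_f(G).$$
   Context: Graphs are finite and simple. The strong product $G\boxtimes H$ has vertex set $V(G)\times V(H)$, where $(u,u')$ and $(v,v')$ are adjacent if (i) $u=v$ and $u'\sim v'$ in $H$, or (ii) $u'=v'$ and $u\sim v$ in $G$, or (iii) $u\sim v$ in $G$ and $u'\sim v'$ in $H$. $K_{d+1}$ is the complete graph on $d+1$ vertices. For $b\ge 1$, a $b$-fold colouring of a graph $G$ is a function assigning to every vertex a subset of size $b$ of a colour set $C\subseteq\mathbb{Z}^+$. It is proper if adjacent vertices receive disjoint sets; it is $d$-improper if, for every colour $x$, the subgraph induced by the vertices having $x$ in their set has maximum degree at most $d$. $\chi_b(G)$ and $\chi_b^d(G)$ denote the minimum number of colours in a proper, respectively $d$-improper, $b$-fold colouring of $G$. Then $\chi_f(G)=\inf\{\chi_b(G)/b : b\in\mathbb{N}, b\ge1\}$ and $\chi_f^d(G)=\inf\{\chi_b^d(G)/b : b\in\mathbb{N}, b\ge 1\}$. *)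

(* Defs.v *)
From mathcomp Require Import all_boot all_order all_algebra.
From mathcomp Require Import finmap.
From mathcomp Require Import boolp classical_sets reals.

Set Implicit Arguments.
Unset Strict Implicit.
Unset Printing Implicit Defensive.

Record sgraph := SGraph {
  vertex :> finType;
  adj : rel vertex;
  adj_sym : symmetric adj;
  adj_irrefl : irreflexive adj }.

Section StrongProduct.
Variables G H : sgraph.

Definition strong_adj : rel (G * H)%type := fun p q =>
  [|| (p.1 == q.1) && adj p.2 q.2,
      (p.2 == q.2) && adj p.1 q.1
    | adj p.1 q.1 && adj p.2 q.2].

Lemma strong_adj_sym : symmetric strong_adj.
Proof.
move=> p q; rewrite /strong_adj (eq_sym q.1) (eq_sym q.2).
by rewrite (adj_sym q.1) (adj_sym q.2).
Qed.

Lemma strong_adj_irrefl : irreflexive strong_adj.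
Proof. by move=> p; rewrite /strong_adj !adj_irrefl !andbF. Qed.

Definition strong_product : sgraph := SGraph strong_adj_sym strong_adj_irrefl.

End StrongProduct.

Section Complete.
Variable n : nat.

Definition complete_adj : rel 'I_n := fun i j => i != j.

Lemma complete_adj_sym : symmetric complete_adj.
Proof. by move=> i j; rewrite /complete_adj eq_sym. Qed.

Lemma complete_adj_irrefl : irreflexive complete_adj.
Proof. by move=> i; rewrite /complete_adj eqxx. Qed.

Definition complete_graph : sgraph := SGraph complete_adj_sym complete_adj_irrefl.

End Complete.

Definition induced_max_degree (G : sgraph) (A : {set G}) : nat :=
  \max_(v in A) #|[set u in A | adj v u]|.

(* Colours are positive integers; since only the minimum number of colours
   matters, the colour set C is taken finite. *)
Definition fold_colouring (G : sgraph) (b : nat) (C : {fset nat})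
    (f : G -> {fset nat}) : Prop :=
  (forall x, x \in C -> 0 < x) /\
  (forall v, (f v `<=` C)%fset /\ #|` f v| = b).

Definition proper_colouring (G : sgraph) (f : G -> {fset nat}) : Prop :=
  forall u v : G, adj u v -> [disjoint f u & f v]%fset.

Definition improper_colouring (G : sgraph) (d : nat) (f : G -> {fset nat})
    : Prop :=
  forall x : nat, induced_max_degree [set v : G | x \in f v]%SET <= d.

Definition fold_colourable (G : sgraph) (b k : nat) : Prop :=
  exists (C : {fset nat}) (f : G -> {fset nat}),
    [/\ #|` C| = k, fold_colouring b C f & proper_colouring f].

Definition improper_fold_colourable (G : sgraph) (d b k : nat) : Prop :=
  exists (C : {fset nat}) (f : G -> {fset nat}),
    [/\ #|` C| = k, fold_colouring b C f & improper_colouring d f].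

Lemma proper_improper (G : sgraph) (d : nat) (f : G -> {fset nat}) :
  proper_colouring f -> improper_colouring d f.
Proof.
move=> fP x; apply/bigmax_leqP => v; rewrite inE => xv.
rewrite (_ : [set _ in _ | _]%SET = finset.set0) ?cards0 //.
apply/setP => u; rewrite !inE; apply/negP => /andP[xu /fP /fdisjointP].
by move=> /(_ x xv); rewrite xu.
Qed.

Lemma ex_fold_colourable (G : sgraph) (b : nat) :
  exists k, `[< fold_colourable G b k >].
Proof.
pose c (v : G) (i : 'I_b) : nat := (choice.pickle (v, i)).+1.
pose f (v : G) : {fset nat} := [fset c v i | i in 'I_b]%fset.
have cI v w i j : c v i = c w j -> (v, i) = (w, j).
  by move=> [] /(pcan_inj choice.pickleK).
pose C : {fset nat} := (\bigcup_(v <- enum G) f v)%fset.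
exists #|` C|; apply/asboolP; exists C, f; split=> //.
  split=> [x /bigfcupP[v _ /imfsetP[i _ ->]] //|v]; split.
    by apply: (@bigfcup_sup _ _ _ v xpredT f) => //; rewrite mem_enum.
  rewrite card_imfset /=; first by rewrite -cardE card_ord.
  by move=> i j /cI[].
move=> u v uv; apply/fdisjointP => x /imfsetP[i _ ->].
apply/negP => /imfsetP[j _ /cI[uE _]].
by move: uv; rewrite uE adj_irrefl.
Qed.

Lemma ex_improper_fold_colourable (G : sgraph) (d b : nat) :
  exists k, `[< improper_fold_colourable G d b k >].
Proof.
have [k /asboolP[C [f [Ck fC fP]]]] := ex_fold_colourable G b.
by exists k; apply/asboolP; exists C, f; split=> //; exact: proper_improper.
Qed.

Definition chi_fold (G : sgraph) (b : nat) : nat :=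
  ex_minn (ex_fold_colourable G b).

Definition chi_improper_fold (G : sgraph) (d b : nat) : nat :=
  ex_minn (ex_improper_fold_colourable G d b).

Local Open Scope ring_scope.
Local Open Scope classical_set_scope.

Definition chi_frac (R : realType) (G : sgraph) : R :=
  inf [set (chi_fold G b)%:R / b%:R | b in [set b : nat | (1 <= b)%N]].

Definition chi_improper_frac (R : realType) (G : sgraph) (d : nat) : R :=
  inf [set (chi_improper_fold G d b)%:R / b%:R | b in [set b : nat | (1 <= b)%N]].

(* Main.v *)
Require Import Defs.
From mathcomp Require Import all_boot all_algebra reals.
From mathcomp Require Import all_order all_fingroup finmap boolp classical_sets.

(** Both inequalities come from transforming colourings.

    A proper [b]-fold colouring of [G] can be pulled back along the projection
    from the strong product onto [G]: a colour class becomes an independent set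
    times the clique, in which every vertex has degree exactly [d].  Hence the
    left-hand side is at most the right-hand side.

    For the converse, independent sets are sampled at random inside the classes
    of an improper colouring.  Let [X] be a set of vertices of a graph [H]
    inducing a subgraph of maximum degree at most [d], and order the vertices
    of [H] by a uniformly random permutation.  The vertices of [X] that precede
    all their neighbours in [X] form an independent set, and each vertex of [X]
    is selected with probability at least [1/(d+1)], because it competes with at
    most [d] others ([card_selected]).  Taking pairs (colour, permutation) as
    new colours turns a [d]-improper [b]-fold colouring of [H] with [k] colours
    into a proper colouring with [k * N] colours, [N] being the number of
    permutations, in which every vertex has at least [b * N / (d+1)] colours
    ([card_refined]).

    For [H] the strong product of [G] with the clique on [d+1] vertices, give
    each vertex [v] of [G] the union of the new colour sets of its [d+1] copies.
    The copies of [v] are pairwise adjacent, so these sets are disjoint and [v]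
    gets at least [b * N] colours: the factor [d+1] lost by sampling is
    recovered.  The copies of adjacent vertices are also adjacent, so the
    colouring of [G] is proper ([chi_fold_strong_product_le]), and the ratio
    [k * N / (b * N)] is the original one. *)

Set Implicit Arguments.
Unset Strict Implicit.
Unset Printing Implicit Defensive.

(** * First elements under a random order *)

Section RandomOrder.
Variable T : finType.
Implicit Types (s : {perm T}) (S : {set T}) (p q : T).

Definition precedes s p q : bool := enum_rank (s p) <= enum_rank (s q).

Lemma precedes_anti s p q : precedes s p q -> precedes s q p -> p = q.
Proof.
move=> pq qp; apply/(@perm_inj _ s)/enum_rank_inj/val_inj/eqP.
by rewrite eqn_leq; apply/andP.
Qed.

Definition is_first s S p : bool := (p \in S) && [forall q in S, precedes s p q].

Lemma sum_is_first s S p : p \in S -> \sum_(q in S) is_first s S q = 1.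
Proof.
move=> pS.
case: (arg_minnP (fun q => enum_rank (s q) : nat) pS) => m mS mmin.
have m1 : is_first s S m by apply/andP; split=> //; apply/forall_inP.
rewrite (bigD1 m) //= m1 big1 // => q /andP[qS qm].
apply/eqP; rewrite eqb0; apply: contraNN qm => /andP[_ /forall_inP qmin].
by apply/eqP/(@precedes_anti s); [exact: qmin | exact: mmin].
Qed.

(** Composing with the transposition of [p] and [q] exchanges the orders in
    which [p] comes first with those in which [q] does. *)
Lemma card_is_first_le S p q : p \in S -> q \in S ->
  #|[set s | is_first s S p]| <= #|[set s | is_first s S q]|.
Proof.
move=> pS qS; have tS r : (tperm p q r \in S) = (r \in S).
  by case: tpermP => [->|->|//]; rewrite pS qS.
rewrite -(card_imset _ (mulgI (tperm p q))); apply/subset_leq_card/fintype.subsetP.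
move=> _ /imsetP[s sp ->]; move: sp; rewrite !inE => /andP[_ /forall_inP sp].
rewrite /is_first qS; apply/forall_inP => r rS.
by rewrite /precedes !permM tpermR; apply: sp; rewrite tS.
Qed.

(** By symmetry all elements of [S] come first equally often. *)
Lemma card_is_first S p : p \in S ->
  #|S| * #|[set s | is_first s S p]| = #|{perm T}|.
Proof.
move=> pS; rewrite -sum_nat_const.
transitivity (\sum_(q in S) \sum_(s : {perm T}) is_first s S q).
  apply: eq_bigr => q qS; transitivity #|[set s | is_first s S q]|.
    by apply/eqP; rewrite eqn_leq !card_is_first_le.
  by rewrite -sum1dep_card big_mkcond; apply: eq_bigr => s _; case: is_first.
rewrite exchange_big /= -sum1_card.
by apply: eq_bigr => s _; exact: sum_is_first pS.
Qed.

End RandomOrder.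

(** * Random independent sets *)

Section Selection.
Variable H : sgraph.
Implicit Types (s : {perm H}) (X : {set H}) (p q : H).

Definition closed_nbhd X p : {set H} := [set q in X | (q == p) || adj p q]%SET.

Lemma card_closed_nbhd X d p : induced_max_degree X <= d -> p \in X ->
  #|closed_nbhd X p| <= d.+1.
Proof.
move=> /bigmax_leqP/(_ p) Xd pX.
have -> : closed_nbhd X p = (p |: [set q in X | adj p q])%SET.
  by apply/setP => q; rewrite !inE; case: eqP => // ->; rewrite pX.
by rewrite cardsU1 !inE adj_irrefl andbF; exact: Xd.
Qed.

Definition selected s X p : bool := is_first s (closed_nbhd X p) p.

Lemma selected_sub s X p : selected s X p -> p \in X.
Proof. by rewrite /selected /is_first !inE => /andP[/andP[]]. Qed.

(** Two adjacent selected vertices would each precede the other. *)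
Lemma selected_nonadj s X p q :
  selected s X p -> selected s X q -> ~~ adj p q.
Proof.
move=> sp sq; apply/negP => pq.
have [pX qX] := (selected_sub sp, selected_sub sq).
case/andP: sp => _ /forall_inP/(_ q); rewrite !inE qX pq orbT => /(_ isT) Hpq.
case/andP: sq => _ /forall_inP/(_ p).
rewrite !inE pX adj_sym pq orbT => /(_ isT) Hqp.
by move: pq; rewrite (precedes_anti Hpq Hqp) adj_irrefl.
Qed.

(** A vertex of [X] comes first among the at most [d+1] vertices of its closed
    neighbourhood with probability at least [1/(d+1)]. *)
Lemma card_selected X d p : induced_max_degree X <= d -> p \in X ->
  #|{perm H}| <= d.+1 * #|[set s | selected s X p]|.
Proof.
move=> Xd pX; rewrite -(@card_is_first _ (closed_nbhd X p) p).
  by rewrite leq_mul2r card_closed_nbhd // orbT.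
by rewrite !inE pX eqxx.
Qed.

End Selection.

(** * Proper colourings from improper ones *)

Section Refinement.
Variables (H : sgraph) (d b : nat) (C : {fset nat}) (f : H -> {fset nat}).
Hypotheses (fC : fold_colouring b C f) (fd : improper_colouring d f).

Definition colour_class (x : nat) : {set H} := [set p | x \in f p]%SET.

(** The selections obtained from all orders, made within each class of [f],
    are the classes of a proper colouring whose colours are pairs. *)
Definition refined (p : H) : {set C * {perm H}} :=
  [set c | selected c.2 (colour_class (val c.1)) p]%SET.

Lemma refined_disjoint p q : adj p q -> [disjoint refined p & refined q].
Proof.
move=> pq; apply/pred0Pn => -[c /andP[]]; rewrite !inE => cp cq.
by move: (selected_nonadj cp cq); rewrite pq.
Qed.

Lemma card_refined p : b * #|{perm H}| <= d.+1 * #|refined p|.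
Proof.
have [fpC cfp] := fC.2 p.
have -> : #|refined p| =
    \sum_(x : C) #|[set s | selected s (colour_class (val x)) p]|.
  rewrite -sum1dep_card -(pair_big_dep xpredT
    (fun x s => selected s (colour_class (val x)) p) (fun _ _ => 1)) /=.
  by apply: eq_bigr => x _; rewrite sum1dep_card.
rewrite big_distrr /=.
(* Write [b] as a sum over [C], to compare the two sides colour by colour. *)
have -> : b = \sum_(x : C | val x \in f p) 1.
  rewrite -cfp cardfE sum1_card.
  rewrite -(card_imset _ (@fincl_inj _ _ _ fpC)); apply: eq_card => x.
  apply/imsetP/idP => [[y _ ->]|xp]; first exact: (valP y).
  by exists [` xp]%fset => //; exact: val_inj.
rewrite big_distrl big_mkcond /=; apply: leq_sum => x _.
case: ifP => // xp; rewrite mul1n; apply: card_selected; first exact: fd.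
by rewrite inE.
Qed.

End Refinement.

Lemma exists_subset_card (T : finType) (A : {set T}) n :
  n <= #|A| -> exists2 B : {set T}, B \subset A & #|B| = n.
Proof.
move=> nA; have /card_gt0P[B] : 0 < #|[set B : {set T} | B \subset A & #|B| == n]%SET|.
  by rewrite cards_draws bin_gt0.
by rewrite inE => /andP[BA /eqP Bn]; exists B.
Qed.

(** Surplus colours are discarded, and colours from an arbitrary finite type
    are renamed to positive integers. *)
Lemma chi_fold_le_card (G : sgraph) (K : finType) (h : G -> {set K}) b :
  (forall v, b <= #|h v|) ->
  (forall u v, adj u v -> [disjoint h u & h v]) ->
  chi_fold G b <= #|K|.
Proof.
move=> hb hdisj.
have /boolp.choice[g gP] (v : G) : exists B : {set K}, B \subset h v /\ #|B| = b.
  by have [B] := exists_subset_card (hb v); exists B.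
pose num (c : K) : nat := (choice.pickle c).+1.
have num_inj : injective num by move=> c e [] /(pcan_inj choice.pickleK).
rewrite /chi_fold; case: ex_minnP => m _; apply; apply/asboolP.
exists [fset num c | c in K]%fset.
exists (fun v => [fset num c | c in g v]%fset).
split; [by rewrite card_imfset //= -cardE | split=> [_ /imfsetP[c _ ->] //|v] | ].
  split; last by rewrite card_imfset //= -cardE (gP v).2.
  by apply/fsubsetP => _ /imfsetP[c _ ->]; rewrite in_imfset.
move=> u v /hdisj huv; apply/fdisjointP => _ /imfsetP[c /= cu ->].
apply/imfsetP => -[e /= ev /num_inj ce]; rewrite -{}ce in ev.
move/disjointFr/(_ (fintype.subsetP (gP u).1 c cu)): huv.
by rewrite (fintype.subsetP (gP v).1 c ev).
Qed.

(** * Fold colourings of the strong product *)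

Local Notation blowup G d := (strong_product G (complete_graph d.+1)).

(** The fibre of [v] is a clique of [d+1] vertices, so the disjoint union of
    the refined colour sets over it compensates for the loss in
    [card_refined]. *)
Lemma chi_fold_strong_product_le (G : sgraph) d b :
  chi_fold G (b * #|{perm blowup G d}|) <=
  chi_improper_fold (blowup G d) d b * #|{perm blowup G d}|.
Proof.
set H := blowup G d; rewrite /chi_improper_fold.
case: ex_minnP => k /asboolP[C [f [<- fC fd]]] _.
pose g := refined C f.
pose fibre (v : G) (i : 'I_d.+1) : H := (v, i).
pose h v := (\bigcup_(i : 'I_d.+1) g (fibre v i))%SET.
rewrite cardfE -card_prod; apply: (chi_fold_le_card (h := h)) => [v|u v uv].
  have -> : #|h v| = \sum_(i : 'I_d.+1) #|g (fibre v i)|.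
    rewrite -sum1_card partition_disjoint_bigcup.
      by apply: eq_bigr => i _; rewrite sum1_card.
    move=> i j ij; apply: refined_disjoint.
    by rewrite /= /strong_adj /= eqxx /complete_adj ij.
  rewrite -(leq_pmul2l (ltn0Sn d)) big_distrr /=.
  rewrite -[X in X * _ <= _](card_ord d.+1) -sum_nat_const.
  by apply: leq_sum => i _; exact: (card_refined fC fd).
apply/pred0Pn => -[c /andP[/bigcupP[i _ ci] /bigcupP[j _ cj]]].
have ij : adj (fibre u i) (fibre v j).
  by rewrite /= /strong_adj /= uv /complete_adj andbT; case: (i == j); rewrite ?orbT.
by rewrite (disjointFr (refined_disjoint C f ij) ci) in cj.
Qed.

(** Colouring each vertex of the product like its projection: two vertices of a
    colour class can be adjacent only when they share their projection, which
    leaves at most [d] neighbours. *)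
Lemma chi_improper_fold_strong_product_le (G : sgraph) d b :
  chi_improper_fold (blowup G d) d b <= chi_fold G b.
Proof.
rewrite /chi_fold; case: ex_minnP => k /asboolP[C [f [Ck [C0 fC] fP]]] _.
rewrite /chi_improper_fold; case: ex_minnP => m _; apply; apply/asboolP.
exists C, (fun p => f p.1); split=> //.
move=> x; apply/bigmax_leqP => -[v i]; rewrite inE /= => xv.
have others : #|[set (v, j) | j in [set~ i]]%SET| = d.
  by rewrite card_imset ?cardsC1 ?card_ord // => j j' [].
apply: (leq_trans _ (eq_leq others)); apply/subset_leq_card/fintype.subsetP => -[u j].
rewrite !inE /= /strong_adj /= => /andP[xu].
have -> : adj v u = false.
  by apply/negP => /fP/fdisjointP/(_ x xv); rewrite xu.
rewrite andbF andFb !orbF => /andP[/eqP <- ij].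
by apply/imsetP; exists j; rewrite // !inE eq_sym.
Qed.

(** * Comparison of the infima *)

Section Infimum.
Import Order.TTheory GRing.Theory Num.Theory.
Local Open Scope ring_scope.
Local Open Scope classical_set_scope.
Variable R : realType.

(** The factor [N] may depend on [b] because it cancels in the ratio. *)
Lemma inf_ratio_le (c e : nat -> nat) :
  (forall b, (0 < b)%N ->
     exists2 N, (0 < N)%N & (c (b * N) <= e b * N)%N) ->
  inf [set ((c b)%:R / b%:R : R) | b in [set b : nat | (1 <= b)%N]] <=
  inf [set ((e b)%:R / b%:R : R) | b in [set b : nat | (1 <= b)%N]].
Proof.
move=> ce; apply: lb_le_inf; first by exists ((e 1%N)%:R / 1%:R); exists 1%N.
move=> _ [b /= b0 <-]; have [N N0 cN] := ce b b0.
apply: (@le_trans _ _ ((c (b * N)%N)%:R / (b * N)%:R)).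
  apply: ge_inf; last by exists (b * N)%N => //=; rewrite muln_gt0 b0.
  by exists 0 => _ [a _ <-]; rewrite divr_ge0.
rewrite ler_pdivrMr ?ltr0n ?muln_gt0 ?b0 // natrM mulrA divfK ?pnatr_eq0 -?lt0n //.
by rewrite -natrM ler_nat.
Qed.

End Infimum.

Theorem theorem5 (R : realType) (G : sgraph) (d : nat) (hd : 0 < d) :
  chi_improper_frac R (strong_product G (complete_graph d.+1)) d = chi_frac R G.
Proof.
apply: Order.POrderTheory.le_anti; apply/andP; split; apply: inf_ratio_le => b _.
  exists 1 => //; rewrite !muln1; exact: chi_improper_fold_strong_product_le.
exists #|{perm blowup G d}|.
  by apply/card_gt0P; exists 1%g.
exact: chi_fold_strong_product_le.
Qed.
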